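(* Let $1\le k<d$ be integers and let $A\subset\mathbb{R}^d$ be a homogeneous set with $\overline{\dim}_B(A)<t<\frac{d-k}{2}$. Then there is an exceptional set $E\subset G(d,k)$ with $\dim_H E\le (k-1)(d-k)+2t$ such that for every $V\in G(d,k)\setminus E$ there is a Lipschitz function $f_V\colon V^\perp\to V$ whose graph covers $A$.
   Context: A set $M\subset\mathbb{R}^d$ is a miniset of $A\subset\mathbb{R}^d$ if there is an expanding homothety $h(x)=rx+u$ ($r>1$, $u\in\mathbb{R}^d$) such that $M\subset h(A)$. A compact set $K$ is a microset of $A$ if there is a sequence of compact minisets of $A$ converging to $K$ in the Hausdorff metric. A compact set $A$ is homogeneous if every microset of $A$ is also a miniset of $A$. $\overline{\dim}_B$ is upper box counting dimension, $\dim_H$ is Hausdorff dimension. $G(d,k)$ is the Grassmannian of $k$-dimensional linear subspaces of $\mathbb{R}^d$ with metric $\varrho(V,W)=\|P_V-P_W\|$ (operator norm), $P_V$ being the orthogonal projection of $\mathbb{R}^d$ onto $V^\perp$. The graph of $f\colon V^\perp\to V$ is $\{y+f(y):y\in V^\perp\}\subset\mathbb{R}^d$; it covers $A$ if it contains $A$. *)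

(* Defs.v *)
From HB Require Import structures.
From mathcomp Require Import all_boot all_order all_algebra.
From mathcomp Require Import all_classical all_reals all_analysis.

Set Implicit Arguments.
Unset Strict Implicit.
Unset Printing Implicit Defensive.

Import Order.TTheory GRing.Theory Num.Theory.
Import numFieldNormedType.Exports.

Local Open Scope classical_set_scope.
Local Open Scope ring_scope.

Section DistanceNotions.
Context {R : realType} {T : Type}.
Variable dist : T -> T -> R.
Implicit Types (A B U : set T) (s delta : R).

(* diam set0 = 0 *)
Definition diam U : \bar R :=
  ereal_sup (0%E |` [set (dist p.1 p.2)%:E | p in U `*` U]).

Definition hausdorff_dist A B : \bar R :=
  ereal_inf [set e%:E | e in [set e : R | [/\ 0 <= e,
    forall x, A x -> exists2 y, B y & dist x y <= e &
    forall y, B y -> exists2 x, A x & dist x y <= e]]].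

(* the smallest number of sets of diameter at most delta covering A;
   +oo if there is no finite cover *)
Definition covering_number A delta : \bar R :=
  ereal_inf [set n%:R%:E | n in [set n : nat | exists U : 'I_n -> set T,
    (forall i, (diam (U i) <= delta%:E)%E) /\ A `<=` \bigcup_i U i]].

(* limsup of ln N(A, delta) / - ln delta as delta -> 0+.
   The maximum with 0 only matters for A = set0, where ln 0 = -oo: the empty
   set gets dimension 0, as it does for hausdorff_dim. *)
Definition upper_box_dim A : \bar R :=
  maxe 0%E (limf_esup
    (fun delta => lne (covering_number A delta) * ((- ln delta)^-1)%:E)%E 0^'+).

(* diam(U)^s, where 0^0 = 1 except for the empty set, which contributes 0 *)
Definition hausdorff_gauge s U : \bar R :=
  if `[< U = set0 >] then 0%E else (diam U `^ s)%E.

Definition hausdorff_premeasure s delta A : \bar R :=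
  ereal_inf [set (\sum_(0 <= i <oo) hausdorff_gauge s (U i))%E |
    U in [set U : nat -> set T |
      (forall i, (diam (U i) <= delta%:E)%E) /\ A `<=` \bigcup_i U i]].

Definition hausdorff_measure s A : \bar R :=
  ereal_sup [set hausdorff_premeasure s delta A |
    delta in [set delta : R | 0 < delta]].

Definition hausdorff_dim A : \bar R :=
  ereal_inf [set s%:E | s in
    [set s : R | 0 <= s /\ hausdorff_measure s A = 0%E]].

End DistanceNotions.

Section Euclidean.
Context {R : realType} {d : nat}.
Implicit Types (u v x y : 'rV[R]_d) (V W : {vspace 'rV[R]_d}).

Definition eucl_dot u v : R := \sum_(i < d) u 0 i * v 0 i.

Lemma eucl_dot_is_bilinear :
  bilinear_for
    (GRing.Scale.Law.clone _ _ ( *%R : R -> R -> R) _)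
    (GRing.Scale.Law.clone _ _ (idfun \; *%R : R -> R -> R) _)
    eucl_dot.
Proof.
split=> [u'|u] a x y /=; rewrite /eucl_dot mulr_sumr -big_split/=;
  apply: eq_bigr => i _; rewrite !mxE; first by rewrite mulrDl mulrA.
by rewrite mulrDr mulrCA.
Qed.

HB.instance Definition _ := bilinear_isBilinear.Build R _ _ _
  (GRing.Scale.Law.clone _ _ ( *%R : R -> R -> R) _)
  (GRing.Scale.Law.clone _ _ (idfun \; *%R : R -> R -> R) _)
  eucl_dot eucl_dot_is_bilinear.

Lemma eucl_dot_is_hermitian u v :
  eucl_dot u v = (-1) ^+ false * idfun (eucl_dot v u).
Proof.
by rewrite expr0 mul1r /eucl_dot; apply: eq_bigr => i _; rewrite mulrC.
Qed.

HB.instance Definition _ := isHermitianSesquilinear.Build R _ false idfun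
  eucl_dot eucl_dot_is_hermitian.

(* The library norm on 'rV[R]_d is the max norm, not this one. *)
Definition eucl_norm x : R := Num.sqrt (eucl_dot x x).

Definition eucl_dist x y : R := eucl_norm (x - y).

Definition opnorm (f : 'End('rV[R]_d)) : R :=
  sup [set eucl_norm (f x) | x in [set x | eucl_norm x <= 1]].

Definition ocompl V : {vspace 'rV[R]_d} := orthov eucl_dot V.

(* the projection onto V^perp along V *)
Definition oproj V : 'End('rV[R]_d) := daddv_pi (ocompl V) V.

Definition Grassmannian (k : nat) : set {vspace 'rV[R]_d} :=
  [set V | \dim V = k].

Definition grass_dist V W : R := opnorm (oproj V - oproj W).

Definition graph_of V (f : subvs_of (ocompl V) -> subvs_of V) : set 'rV[R]_d :=
  [set vsval y + vsval (f y) | y in setT].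

Definition is_lipschitz V (f : subvs_of (ocompl V) -> subvs_of V) : Prop :=
  exists L : R, forall x y : subvs_of (ocompl V),
    eucl_dist (vsval (f x)) (vsval (f y)) <= L * eucl_dist (vsval x) (vsval y).

Definition miniset (M A : set 'rV[R]_d) : Prop :=
  exists (r : R) (u : 'rV[R]_d), 1 < r /\ M `<=` [set r *: x + u | x in A].

Definition microset (K A : set 'rV[R]_d) : Prop :=
  compact K /\
  exists M : nat -> set 'rV[R]_d,
    (forall n, compact (M n) /\ miniset (M n) A) /\
    hausdorff_dist eucl_dist (M n) K @[n --> \oo] --> 0%E.

Definition homogeneous (A : set 'rV[R]_d) : Prop :=
  compact A /\ forall K, microset K A -> miniset K A.

End Euclidean.

(* Main.v *)
(* A Lipschitz graph over the orthogonal complement of [V] covers [A] as soon as the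
   orthogonal projection shrinks the differences of points of [A] by at most a
   constant factor. Otherwise [V] contains a limit [e] of directions of [A]; the pair
   [{0, e}], suitably scaled, is a microset, hence a miniset of [A], so some difference
   [x - y] of distinct points of [A] lies in [V].
   The exceptional [V] are thus those containing such an [x - y]. If [A] is covered by
   [n] sets of diameter [delta], those with [x - y] bounded away from [0] are covered by
   at most [C n^2 delta^-((k-1)(d-k))] sets of diameter [C delta]: the pair of sets
   containing [x] and [y] fixes one row of a [k x d] matrix spanning [V] up to
   [C delta] once the [k-1] other rows, with [d-k] free entries each, are known. *)
Require Import Defs.
From HB Require Import structures.
From mathcomp Require Import all_boot all_order all_algebra.
From mathcomp Require Import all_classical all_reals all_analysis.
From mathcomp Require Import ring lra.
Set Implicit Arguments.
Unset Strict Implicit.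
Unset Printing Implicit Defensive.
Import Order.TTheory GRing.Theory Num.Theory.
Import numFieldNormedType.Exports.
Local Open Scope classical_set_scope.
Local Open Scope ring_scope.

(** * Euclidean inner product and norm *)

Section EuclideanNorm.
Context {R : realType} {d : nat}.
Implicit Types (u v x y : 'rV[R]_d).

Lemma eucl_dotC u v : eucl_dot u v = eucl_dot v u.
Proof. by apply: eq_bigr => i _; rewrite mulrC. Qed.

Lemma eucl_dotDl u v x : eucl_dot (u + v) x = eucl_dot u x + eucl_dot v x.
Proof. by rewrite -big_split; apply: eq_bigr => i _; rewrite mxE mulrDl. Qed.

Lemma eucl_dotZl a u v : eucl_dot (a *: u) v = a * eucl_dot u v.
Proof. by rewrite mulr_sumr; apply: eq_bigr => i _; rewrite mxE mulrA. Qed.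

Lemma eucl_dotNl u v : eucl_dot (- u) v = - eucl_dot u v.
Proof. by rewrite -scaleN1r eucl_dotZl mulN1r. Qed.

Lemma eucl_dotDr u v x : eucl_dot x (u + v) = eucl_dot x u + eucl_dot x v.
Proof. by rewrite eucl_dotC eucl_dotDl !(eucl_dotC _ x). Qed.

Lemma eucl_dotNr u v : eucl_dot u (- v) = - eucl_dot u v.
Proof. by rewrite eucl_dotC eucl_dotNl eucl_dotC. Qed.

Lemma eucl_dotZr a u v : eucl_dot u (a *: v) = a * eucl_dot u v.
Proof. by rewrite eucl_dotC eucl_dotZl eucl_dotC. Qed.

Lemma eucl_dot_ge0 u : 0 <= eucl_dot u u.
Proof. by apply: sumr_ge0 => i _; rewrite -expr2 sqr_ge0. Qed.

Lemma eucl_dot_eq0 u : eucl_dot u u = 0 -> u = 0.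
Proof.
move=> /psumr_eq0P u0; apply/rowP => i; rewrite mxE.
apply/eqP; rewrite -sqrf_eq0 expr2 u0 // => j _.
by rewrite -expr2 sqr_ge0.
Qed.

Lemma eucl_norm_ge0 u : 0 <= eucl_norm u.
Proof. exact: sqrtr_ge0. Qed.

Lemma sqr_eucl_norm u : eucl_norm u ^+ 2 = eucl_dot u u.
Proof. by rewrite sqr_sqrtr ?eucl_dot_ge0. Qed.

Lemma eucl_norm0 : eucl_norm (0 : 'rV[R]_d) = 0.
Proof. by apply/eqP; rewrite -sqrf_eq0 sqr_eucl_norm -(scale0r (0 : 'rV[R]_d)) eucl_dotZl mul0r. Qed.

Lemma eucl_norm_eq0 u : eucl_norm u = 0 -> u = 0.
Proof. by move=> u0; apply: eucl_dot_eq0; rewrite -sqr_eucl_norm u0 expr0n. Qed.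

Lemma eucl_norm_gt0 u : u != 0 -> 0 < eucl_norm u.
Proof.
move=> u0; rewrite lt_neqAle eucl_norm_ge0 andbT eq_sym.
by apply: contra_neq u0 => /eucl_norm_eq0.
Qed.

Lemma eucl_normZ a u : eucl_norm (a *: u) = `|a| * eucl_norm u.
Proof.
rewrite /eucl_norm eucl_dotZl eucl_dotZr mulrA -expr2.
by rewrite sqrtrM ?sqr_ge0 // sqrtr_sqr.
Qed.

Lemma eucl_normN u : eucl_norm (- u) = eucl_norm u.
Proof. by rewrite -scaleN1r eucl_normZ normrN1 mul1r. Qed.

(** Cauchy-Schwarz: with a = v.v and b = u.v, the squared norm of a u - b v is a times a (u.u) -
    b^2, and a is divided out when positive. *)
Lemma eucl_dot_le_norm u v : eucl_dot u v <= eucl_norm u * eucl_norm v.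
Proof.
apply: le_trans (ler_norm _) _.
rewrite -ler_sqr ?nnegrE ?mulr_ge0 ?eucl_norm_ge0 // real_normK ?num_real //.
rewrite exprMn !sqr_eucl_norm.
have := eucl_dot_ge0 (eucl_dot v v *: u - eucl_dot u v *: v).
rewrite !(eucl_dotDl, eucl_dotDr, eucl_dotZl, eucl_dotZr, eucl_dotNl, eucl_dotNr).
rewrite (eucl_dotC v u).
have := eucl_dot_ge0 v; rewrite le_eqVlt => /predU1P[v0|v0].
  have -> : eucl_dot u v = 0.
    by rewrite (eucl_dot_eq0 (esym v0)) -(scale0r (0 : 'rV[R]_d)) eucl_dotZr mul0r.
  by move=> _; rewrite expr0n -v0 mulr0.
move=> h; rewrite -(ler_pM2l v0) -subr_ge0.
by apply: le_trans h _; rewrite le_eqVlt; apply/orP; left; apply/eqP; ring.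
Qed.

Lemma eucl_normD u v : eucl_norm (u + v) <= eucl_norm u + eucl_norm v.
Proof.
rewrite -ler_sqr ?nnegrE ?addr_ge0 ?eucl_norm_ge0 //.
rewrite sqr_eucl_norm sqrrD !sqr_eucl_norm eucl_dotDl !eucl_dotDr.
have := eucl_dot_le_norm u v; rewrite (eucl_dotC v u); lra.
Qed.

Lemma eucl_normB u v : eucl_norm (u - v) <= eucl_norm u + eucl_norm v.
Proof. by rewrite (le_trans (eucl_normD _ _)) // eucl_normN. Qed.

Lemma eucl_distC u v : eucl_dist u v = eucl_dist v u.
Proof. by rewrite /eucl_dist -opprB eucl_normN. Qed.

Lemma eucl_dist_triangle u v x : eucl_dist u x <= eucl_dist u v + eucl_dist v x.
Proof. by rewrite /eucl_dist -(subrK v u) -addrA addrK eucl_normD. Qed.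

Lemma coord_le_eucl_norm u i : `|u 0 i| <= eucl_norm u.
Proof.
rewrite -ler_sqr ?nnegrE ?eucl_norm_ge0 // real_normK ?num_real //.
rewrite sqr_eucl_norm /eucl_dot (bigD1 i) //= -expr2 lerDl.
by apply: sumr_ge0 => j _; rewrite -expr2 sqr_ge0.
Qed.

Lemma eucl_norm_le_sum u : eucl_norm u <= \sum_i `|u 0 i|.
Proof.
have S0 : 0 <= \sum_i `|u 0 i| by apply: sumr_ge0.
rewrite -ler_sqr ?nnegrE ?eucl_norm_ge0 // sqr_eucl_norm.
rewrite expr2 mulr_suml; apply: ler_sum => i _.
rewrite -expr2 -real_normK ?num_real // expr2 ler_wpM2l //.
by rewrite (bigD1 i) //= lerDl; apply: sumr_ge0.
Qed.

Lemma eucl_norm_le_coord u c : (forall i, `|u 0 i| <= c) -> eucl_norm u <= d%:R * c.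
Proof.
move=> uc; apply: le_trans (eucl_norm_le_sum _) _.
apply: le_trans (ler_sum _ (fun i _ => uc i)) _.
by rewrite sumr_const card_ord mulr_natl.
Qed.

Lemma eucl_norm_sum (I : finType) (P : pred I) (F : I -> 'rV[R]_d) :
  eucl_norm (\sum_(i | P i) F i) <= \sum_(i | P i) eucl_norm (F i).
Proof.
elim/big_rec2 : _ => [|i y x _ h]; first by rewrite eucl_norm0.
by apply: le_trans (eucl_normD _ _) _; rewrite lerD2l.
Qed.

End EuclideanNorm.

(** * Orthogonal complements and projections *)

Section OrthogonalProjection.
Context {R : realType} {d : nat}.
Implicit Types (u v w x y z : 'rV[R]_d) (V W : {vspace 'rV[R]_d}).

Lemma ocompl_dot V y v : y \in ocompl V -> v \in V -> eucl_dot y v = 0.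
Proof. by move=> /mem_orthovP yV vV; exact: yV. Qed.

Lemma mem_ocompl V y : {in V, forall v, eucl_dot y v = 0} -> y \in ocompl V.
Proof. by move=> yV; apply/mem_orthovP. Qed.

Lemma mem_ocompl1 u v : (u \in ocompl <[v]>) = (eucl_dot u v == 0).
Proof. exact: mem_orthov1. Qed.

Lemma ocompl_cap V : (ocompl V :&: V = 0)%VS.
Proof.
apply/eqP; rewrite -subv0; apply/subvP => x; rewrite memv_cap => /andP[xo xV].
by rewrite memv0; apply/eqP/eucl_dot_eq0/(ocompl_dot xo xV).
Qed.

Lemma ocompl_add V : (ocompl V + V = fullv)%VS.
Proof.
suff H n : forall V : {vspace 'rV[R]_d}, \dim V = n ->
    forall x, exists2 v, v \in V & x - v \in ocompl V.
  apply/eqP; rewrite eqEsubv subvf /=; apply/subvP => x _.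
  have [v vV xv] := H _ V erefl x.
  by rewrite -(subrK v x) memv_add.
elim: n => [|n IHn] {}V dimV x.
  exists 0; first exact: mem0v.
  apply/mem_orthovP => v; move/eqP: dimV; rewrite dimv_eq0 => /eqP ->.
  by rewrite memv0 => /eqP ->; rewrite linear0r.
(* Gram-Schmidt: project onto the part of [V] orthogonal to one of its vectors,
   then onto that vector. *)
have v0 : vpick V != 0 by rewrite vpick0 -dimv_eq0 dimV.
set v := vpick V in v0; have vV : v \in V by exact: memv_pick.
have vv0 : eucl_dot v v != 0 by apply: contra_neq v0 => /eucl_dot_eq0.
have dimW : \dim (V :&: ocompl <[v]>) = n.
  by rewrite -eq_dim_orthov1 ?dimV //; apply/mem_orthovPn; exists v.
have [w] := IHn _ dimW x; rewrite memv_cap mem_ocompl1 => /andP[wV /eqP wv] xw.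
have dotv u : u \in V -> u - (eucl_dot u v / eucl_dot v v) *: v
    \in (V :&: ocompl <[v]>)%VS.
  move=> uV; rewrite memv_cap memvB ?memvZ //= mem_ocompl1.
  by rewrite eucl_dotDl eucl_dotNl eucl_dotZl divfK // subrr.
exists (w + (eucl_dot x v / eucl_dot v v) *: v); first by rewrite memvD ?memvZ.
apply: mem_ocompl => u uV; rewrite opprD addrA.
have := ocompl_dot xw (dotv _ uV).
have : eucl_dot v (u - (eucl_dot u v / eucl_dot v v) *: v) = 0.
  have := dotv _ uV; rewrite memv_cap mem_ocompl1 => /andP[_ /eqP].
  by rewrite eucl_dotC.
set u' := u - _; move=> vu' xwu'.
(* Orthogonality to [u] is checked on its part [u'] in the smaller space and on its multiple of
   [v]. *)
have -> : u = u' + (eucl_dot u v / eucl_dot v v) *: v by rewrite subrK.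
move: (eucl_dot u v / _) => b; move: u' vu' xwu' => u' vu' xwu'.
rewrite eucl_dotDl !eucl_dotDr xwu' eucl_dotNl eucl_dotZl vu' mulr0 oppr0 !add0r.
rewrite !(eucl_dotDl, eucl_dotNl, eucl_dotZr, eucl_dotZl) wv.
by field.
Qed.

Lemma oproj_mem V x : oproj V x \in ocompl V.
Proof. exact: memv_pi. Qed.

Lemma oprojC_mem V x : x - oproj V x \in V.
Proof.
have := daddv_pi_add (ocompl_cap V); rewrite ocompl_add => /(_ x (memvf _)) xE.
by rewrite -{1}xE -/(oproj V) addrAC subrr add0r memv_pi.
Qed.

Lemma oproj0 V v : v \in V -> oproj V v = 0.
Proof.
move=> vV; apply/eqP; rewrite -memv0 -(ocompl_cap V) memv_cap oproj_mem /=.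
by rewrite -(subKr v (oproj V v)) memvB // oprojC_mem.
Qed.

Lemma oproj_pythagoras V x :
  eucl_norm x ^+ 2 = eucl_norm (oproj V x) ^+ 2 + eucl_norm (x - oproj V x) ^+ 2.
Proof.
rewrite !sqr_eucl_norm -{1 2}(subrK (oproj V x) x).
move: (ocompl_dot (oproj_mem V x) (oprojC_mem V x)).
move: (oproj V x) (x - oproj V x) => p q pq.
by rewrite !(eucl_dotDl, eucl_dotDr) (eucl_dotC q p) pq addr0 add0r addrC.
Qed.

Lemma oproj_norm V x : eucl_norm (oproj V x) <= eucl_norm x.
Proof.
rewrite -ler_sqr ?nnegrE ?eucl_norm_ge0 // (oproj_pythagoras V x) lerDl.
exact: sqr_ge0.
Qed.

Lemma oprojC_norm V x : eucl_norm (x - oproj V x) <= eucl_norm x.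
Proof.
rewrite -ler_sqr ?nnegrE ?eucl_norm_ge0 // (oproj_pythagoras V x) lerDr.
exact: sqr_ge0.
Qed.

Lemma oproj_dist_le V x w : w \in V -> eucl_norm (oproj V x) <= eucl_norm (x - w).
Proof.
by move=> wV; rewrite -[oproj V x]subr0 -(oproj0 wV) -linearB oproj_norm.
Qed.

Lemma grass_dist_le V W c : 0 <= c ->
  (forall v, v \in V -> exists2 w, w \in W & eucl_norm (v - w) <= c * eucl_norm v) ->
  (forall w, w \in W -> exists2 v, v \in V & eucl_norm (w - v) <= c * eucl_norm w) ->
  grass_dist V W <= c *+ 2.
Proof.
move=> c0 VW WV; apply: ge_sup; first by exists (eucl_norm ((oproj V - oproj W) 0)), 0; rewrite /= ?eucl_norm0 ?ler01.
move=> _ [x /= x1 <-].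
set z := oproj V x; set v := x - z.
have -> : (oproj V - oproj W) x = (z - oproj W z) - oproj W v.
  by rewrite !lfunE /= lfunE /= /v linearB /= opprB addrA subrK.
rewrite mulr2n (le_trans (eucl_normB _ _)) // lerD //.
  set q := z - oproj W z.
  have [u uV qu] := WV _ (oprojC_mem W z).
  have [->|/eucl_norm_gt0 q0] := eqVneq q 0; first by rewrite eucl_norm0.
  rewrite -(ler_pM2r q0) -expr2 sqr_eucl_norm.
  (* [z - q] is orthogonal to [q], and [z] is orthogonal to [u]. *)
  have -> : eucl_dot q q = eucl_dot z (q - u).
    rewrite (eucl_dotDr q (- u)) eucl_dotNr (ocompl_dot (oproj_mem V x) uV) subr0.
    rewrite [LHS]eucl_dotDl eucl_dotNl.
    by rewrite (ocompl_dot (oproj_mem W z) (oprojC_mem W z)) subr0.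
  apply: le_trans (eucl_dot_le_norm _ _) _; apply: le_trans (ler_pM _ _ _ qu) _.
  - exact: eucl_norm_ge0.
  - exact: eucl_norm_ge0.
  - exact: le_trans (oproj_norm V x) x1.
  - by rewrite mul1r.
have [w wW vw] := VW _ (oprojC_mem V x).
apply: le_trans (oproj_dist_le v wW) _; apply: le_trans vw _.
rewrite ler_piMr //; exact: le_trans (oprojC_norm V x) x1.
Qed.

End OrthogonalProjection.

(** * Lipschitz extension and graphs *)

Section LipschitzGraph.
Context {R : realType} {d : nat}.
Implicit Types (x y z : 'rV[R]_d) (A X : set 'rV[R]_d) (V : {vspace 'rV[R]_d}).

(* McShane: the infimum of the cones [q x + L |. - x|] is the largest extension. *)
Lemma lipschitz_extension X (q : 'rV[R]_d -> R) (L : R) : 0 <= L ->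
  (forall x y, X x -> X y -> q x - q y <= L * eucl_dist x y) ->
  exists2 g : 'rV[R]_d -> R, {in X, g =1 q} &
    forall x y, `|g x - g y| <= L * eucl_dist x y.
Proof.
move=> L0 qL; have [->|/set0P[x0 Xx0]] := eqVneq X set0.
  exists (fun=> 0) => [x|x y]; first by rewrite in_set0.
  by rewrite subrr normr0 mulr_ge0 ?eucl_norm_ge0.
pose C y := [set q x + L * eucl_dist y x | x in X].
have Cne y : C y !=set0 by exists (q x0 + L * eucl_dist y x0), x0.
have triL x y z : L * eucl_dist x z <= L * eucl_dist x y + L * eucl_dist y z.
  by rewrite -mulrDr ler_wpM2l ?eucl_dist_triangle.
have Clb y : has_lbound (C y).
  exists (q x0 - L * eucl_dist x0 y) => _ [x Xx <-].
  have := qL _ _ Xx0 Xx; have := triL x0 y x; lra.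
exists (fun y => inf (C y)) => [x /set_mem Xx|].
  apply/eqP; rewrite eq_le; apply/andP; split.
    apply: ge_inf => //; exists x => //.
    by rewrite /eucl_dist subrr eucl_norm0 mulr0 addr0.
  apply: lb_le_inf => // _ [y Xy <-].
  by have := qL _ _ Xx Xy; lra.
suff H x y : inf (C x) - inf (C y) <= L * eucl_dist x y.
  by move=> x y; rewrite ler_norml H andbT lerNl opprB eucl_distC H.
rewrite lerBlDr -lerBlDl; apply: lb_le_inf => // _ [z Xz <-].
rewrite lerBlDl; apply: (@le_trans _ _ (q z + L * eucl_dist x z)).
  by apply: ge_inf => //; exists z.
have := triL x y z; lra.
Qed.

(** The bound makes the projection injective on [A] with Lipschitz inverse, so the component along
    [V] of a point of [A] is a Lipschitz function of its projection. This function is extended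
    coordinate by coordinate. *)
Lemma lipschitz_graph_cover A V (c : R) : 0 < c ->
  (forall x y, A x -> A y -> c * eucl_dist x y <= eucl_norm (oproj V (x - y))) ->
  exists f : subvs_of (ocompl V) -> subvs_of V, is_lipschitz f /\ A `<=` graph_of f.
Proof.
move=> c0 cA.
(* The default 0 is taken only off the projection of [A]. *)
pose s p := xget 0 [set a | A a /\ oproj V a = p].
have sP a : A a -> s (oproj V a) = a.
  move=> Aa; rewrite /s; case: xgetP => [b _ [Ab Pab]|/(_ a)]; last by case.
  have := cA _ _ Ab Aa; rewrite linearB /= Pab subrr eucl_norm0.
  rewrite pmulr_rle0 // => ba; apply/eqP; rewrite -subr_eq0; apply/eqP.
  by apply: eucl_norm_eq0; apply/eqP; rewrite eq_le ba eucl_norm_ge0.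
pose q i (p : 'rV[R]_d) : R := (s p - p) 0 i.
have qL i x y : (oproj V @` A) x -> (oproj V @` A) y ->
    q i x - q i y <= c^-1 * eucl_dist x y.
  move=> [a Aa <-] [b Ab <-]; rewrite /q !sP //.
  rewrite ler_pdivlMl // /eucl_dist -linearB.
  apply: le_trans _ (cA _ _ Aa Ab); rewrite ler_pM2l //.
  apply: le_trans _ (oprojC_norm V (a - b)).
  apply: le_trans _ (coord_le_eucl_norm _ i); apply: le_trans _ (ler_norm _).
  by rewrite linearB /= !mxE le_eqVlt; apply/orP; left; apply/eqP; ring.
have cV0 : 0 <= c^-1 by rewrite invr_ge0 ltW.
have /choice[g gP] i : exists g, {in oproj V @` A, g =1 q i} /\
    forall x y, `|g x - g y| <= c^-1 * eucl_dist x y.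
  by have [g] := lipschitz_extension cV0 (qL i); exists g.
pose w (y : 'rV[R]_d) : 'rV[R]_d := \row_i g i y.
(* The extension [w] may leave [V]; subtracting its projection brings it back and changes nothing
   over the projection of [A]. *)
exists (fun y : subvs_of (ocompl V) => vsproj V (w (vsval y) - oproj V (w (vsval y)))); split.
  exists (d%:R * c^-1) => x0 y0 /=; rewrite !vsprojK ?oprojC_mem //.
  move: (vsval x0) (vsval y0) => x y; rewrite {1}/eucl_dist.
  have -> : w x - oproj V (w x) - (w y - oproj V (w y))
    = w x - w y - oproj V (w x - w y).
    by rewrite (linearB (oproj V)) !opprD addrACA.
  apply: le_trans (oprojC_norm _ _) _; rewrite -mulrA.
  by apply: eucl_norm_le_coord => i; rewrite !mxE; have [_] := gP i; apply.
move=> a Aa; exists (vsproj (ocompl V) (oproj V a)) => //.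
rewrite vsprojK ?oproj_mem // vsprojK ?oprojC_mem //.
have -> : w (oproj V a) = a - oproj V a.
  apply/rowP => i; rewrite mxE; have [gE _] := gP i.
  by rewrite gE ?inE; [rewrite /q sP | exists a].
by rewrite [oproj V (_ - _)]oproj0 ?oprojC_mem // subr0 addrC subrK.
Qed.

End LipschitzGraph.

(** * Directions of differences in a homogeneous set *)

Section Homogeneous.
Context {R : realType} {d : nat}.
Implicit Types (x y e : 'rV[R]_d) (A : set 'rV[R]_d) (V : {vspace 'rV[R]_d}).

Lemma eucl_dist_bounded A : compact A ->
  exists2 L : R, 0 < L & forall x y, A x -> A y -> eucl_dist x y < L.
Proof.
move=> /compact_bounded[M [_ MA]].
pose C : R := `|M| + 1.
have CA x i : A x -> `|x 0 i| <= C.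
  move=> Ax; apply: le_trans (MA C _ _ Ax); last by rewrite /C (le_lt_trans (ler_norm _)) // ltrDl.
  rewrite [leRHS]/Num.norm /= mx_normrE; apply/bigmax_geP; right.
  by exists (0, i).
(* The summand 1 makes the bound strict, which later gives a homothety ratio above 1. *)
exists (d%:R * (C + C) + 1).
  by rewrite ltr_wpDl // mulr_ge0 // addr_ge0 // /C addr_ge0.
move=> x y Ax Ay; rewrite ltr_pwDr //; apply: eucl_norm_le_coord => i.
by rewrite !mxE (le_trans (ler_normB _ _)) // lerD // CA.
Qed.

Lemma unit_sphere_cluster (u : nat -> 'rV[R]_d) : (forall n, eucl_norm (u n) = 1) ->
  exists e : 'rV[R]_d, forall (eps : R) n, 0 < eps ->
    exists2 m, (n <= m)%N & eucl_dist (u m) e < eps.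
Proof.
move=> u1; pose B := [set v : 'rV[R]_d | forall i, `[-1, 1]%classic (v 0 i)].
have cB : compact B by apply: (@rV_compact R d (fun=> `[-1, 1]%classic)) => _; exact: segment_compact.
have uB : (u @ \oo) B.
  exists 0%N => // n _ i; rewrite /= in_itv /= -ler_norml -(u1 n).
  exact: coord_le_eucl_norm.
have [e [_ eu]] := cB _ _ uB.
exists e => eps n eps0.
(* The Euclidean norm is at most [d] times the max norm; [d + 1] makes the final bound strict and
   the denominator nonzero. *)
pose r := eps / (d%:R + 1).
have r0 : 0 < r by rewrite divr_gt0 // ltr_wpDl.
have [|v [[m nm <-] er]] := eu (u @` [set m | (n <= m)%N]) (ball e r) _ (nbhsx_ballx e r r0).
  by exists n => // m /= nm; exists m.
exists m => //.
have : eucl_norm (u m - e) <= d%:R * r.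
  apply: eucl_norm_le_coord => i; rewrite !mxE distrC.
  by apply: ltW; case: er => _; exact.
move=> /le_lt_trans; apply; rewrite /r mulrA ltr_pdivrMr ?ltr_wpDl //.
by rewrite mulrDr mulr1 mulrC ltrDl.
Qed.

(** The homothety of ratio [L / r] with [y] sent to 0 sends [x] to [L *: u n]; its ratio exceeds 1
    because [r] is the distance of [x] and [y]. These pairs converge to the pair of 0 and
    [L *: e]. *)
Lemma microset_segment A (L : R) (u : nat -> 'rV[R]_d) e : 0 < L ->
  (forall x y, A x -> A y -> eucl_dist x y < L) ->
  (forall n, exists x y (r : R), [/\ A x, A y, 0 < r, eucl_norm (u n) = 1 & x - y = r *: u n]) ->
  (forall n, eucl_dist (u n) e < n.+1%:R^-1) ->
  microset [set 0; L *: e] A.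
Proof.
move=> L0 AL uA ue; split.
  by apply: compactU; exact: compact_set1.
exists (fun n => [set 0; L *: u n]); split.
  move=> n; split; first by apply: compactU; exact: compact_set1.
  have [x [y [r [Ax Ay r0 un1 xyE]]]] := uA n.
  exists (L / r), (- ((L / r) *: y)); split.
    rewrite ltr_pdivlMr // mul1r; have := AL _ _ Ax Ay.
    by rewrite /eucl_dist xyE eucl_normZ un1 mulr1 gtr0_norm.
  move=> _ [|] ->; first by exists y => //; rewrite subrr.
  by exists x => //; rewrite -scalerBr xyE scalerA divfK // gt_eqF.
apply: (@squeeze_cvge nat \oo _ R (fun=> 0%E) _ (fun n => (L * n.+1%:R^-1)%:E)).
- apply: nearW => n; apply/andP; split.
    by apply: le_ereal_inf_tmp => _ [r [r0 _ _] <-]; rewrite lee_fin.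
  have h : eucl_dist (L *: u n) (L *: e) <= L * n.+1%:R^-1.
    rewrite /eucl_dist -scalerBr eucl_normZ gtr0_norm // ler_pM2l //.
    exact/ltW/ue.
  have h0 : eucl_dist 0 (0 : 'rV[R]_d) <= L * n.+1%:R^-1.
    by rewrite /eucl_dist subrr eucl_norm0 mulr_ge0 ?ltW // invr_gt0.
  apply: ereal_inf_lbound; exists (L * n.+1%:R^-1) => //; split.
  + by rewrite mulr_ge0 ?ltW // invr_gt0.
  + by move=> _ [|] ->; [exists 0 => //; left|exists (L *: e) => //; right].
  + by move=> _ [|] ->; [exists 0 => //; left|exists (L *: u n) => //; right].
- exact: cvg_cst.
- apply: cvg_EFin; first exact: nearW.
  rewrite -[X in _ --> X](mulr0 L); apply: cvgMr.
  exact: cvg_harmonic.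
Qed.

Lemma homogeneous_oproj_bound A V : homogeneous A ->
  (forall x y, A x -> A y -> x - y \in V -> x = y) ->
  exists2 c : R, 0 < c &
    forall x y, A x -> A y -> c * eucl_dist x y <= eucl_norm (oproj V (x - y)).
Proof.
move=> [cA hA] AV; apply: contrapT => noc.
have [L L0 AL] := eucl_dist_bounded cA.
(* Where the constant [1 / (n + 1)] fails, the offending difference is normalized to a unit
   vector. *)
have H n : {u : 'rV[R]_d | (exists x y (r : R),
    [/\ A x, A y, 0 < r, eucl_norm u = 1 & x - y = r *: u]) /\
    eucl_norm (oproj V u) <= n.+1%:R^-1}.
  apply: cid; apply: contrapT => nou; apply: noc; exists n.+1%:R^-1; first by rewrite invr_gt0.
  move=> x y Ax Ay; rewrite leNgt; apply/negP => xylt; apply: nou.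
  have xy0 : 0 < eucl_dist x y.
    rewrite lt_neqAle eucl_norm_ge0 andbT; apply/eqP => xy0.
    by move: xylt; rewrite -xy0 mulr0 ltNge eucl_norm_ge0.
  exists ((eucl_dist x y)^-1 *: (x - y)); split.
    exists x, y, (eucl_dist x y); split => //.
      by rewrite eucl_normZ gtr0_norm ?invr_gt0 // mulVf // gt_eqF.
    by rewrite scalerA mulfV ?scale1r // gt_eqF.
  by rewrite linearZ /= eucl_normZ gtr0_norm ?invr_gt0 // ler_pdivrMl // mulrC ltW.
have u1 n : eucl_norm (sval (H n)) = 1 by have [[? [? [? []]]]] := svalP (H n).
have [e ue] := unit_sphere_cluster u1.
have nV (n : nat) : 0 < (n.+1%:R^-1 : R) by rewrite invr_gt0.
have /choice[phi phiP] n : exists m, (n <= m)%N /\ eucl_dist (sval (H m)) e < n.+1%:R^-1.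
  by have [m] := ue _ n (nV n); exists m.
have /hA[r [v [r1]]] : microset [set 0; L *: e] A.
  apply: (@microset_segment _ _ (fun n => sval (H (phi n)))) => // n.
    by have [] := svalP (H (phi n)).
  by have [] := phiP n.
have small (a b : R) : 0 <= b -> (forall n, a <= b * n.+1%:R^-1) -> a <= 0.
  move=> b0 ab; rewrite leNgt; apply/negP => a0.
  have := ab (Num.truncn (b / a)); rewrite ler_pdivlMr //.
  by have := truncnS_gt (b / a); rewrite ltr_pdivrMr // mulrC => /lt_le_trans h /h; rewrite ltxx.
have Pe : oproj V e = 0.
  apply: eucl_norm_eq0; apply/eqP; rewrite eq_le eucl_norm_ge0 andbT.
  apply: (small _ 2) => // n; have [nphi ue1] := phiP n.
  set w := sval _ in ue1; have [_ Pw] := svalP (H (phi n)).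
  have -> : oproj V e = oproj V w - oproj V (w - e) by rewrite linearB /= subKr.
  rewrite (le_trans (eucl_normB _ _)) // [leRHS]mulr_natl mulr2n lerD //.
    by rewrite (le_trans Pw) // lef_pV2 ?posrE // ler_nat ltnS.
  by rewrite (le_trans (oproj_norm _ _)) // ltW.
(* [e] is at distance less than 1 from a unit vector. *)
have e0 : e != 0.
  apply/eqP => e0; have [_] := phiP 0%N.
  by rewrite /eucl_dist e0 subr0 u1 invr1 ltxx.
(* Points [x] and [y] of [A] are sent to 0 and [L *: e], so [y - x] is a nonzero multiple of [e] and
   lies in [V]. *)
move=> sub; have [x Ax xE] := sub 0 (or_introl erefl).
have [y Ay yE] := sub (L *: e) (or_intror erefl).
have LeE : L *: e = r *: (y - x).
  by rewrite scalerBr -(addrK v (r *: y)) yE -[in RHS]addrA -opprD [v + _]addrC xE subr0.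
have r0 : r != 0 by rewrite gt_eqF // (lt_trans ltr01).
have yx : y = x.
  apply: AV => //; rewrite -[y - x]scale1r -(mulVf r0) -scalerA -LeE !memvZ //.
  by rewrite -[e]subr0 -Pe oprojC_mem.
move/eqP: LeE; rewrite yx subrr scaler0 scaler_eq0 (negPf e0) orbF.
by rewrite gt_eqF.
Qed.

End Homogeneous.

(** * Frames as coordinates on the Grassmannian *)

Section GrassmannianFrames.
Context {R : realType} {d : nat}.
Implicit Types (v w x y : 'rV[R]_d) (V W : {vspace 'rV[R]_d}).

(* [V] is the graph of a linear map over the coordinate subspace selected by [f],
   and the matrix of this map has entries in [-1, 1]. *)
Definition frame k V (f : {ffun 'I_k -> 'I_d}) (N : 'M[R]_(k, d)) : Prop :=
  [/\ forall i j, N i (f j) = (i == j)%:R,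
      forall i l, `|N i l| <= 1,
      forall i, row i N \in V &
      forall v, v \in V -> v = \sum_j v 0 (f j) *: row j N].

(* Select the columns of a basis whose minor is maximal in absolute value;
   by Cramer's rule the entries of [N] are then quotients of minors by it. *)
Lemma frame_exists k V : \dim V = k ->
  exists (f : {ffun 'I_k -> 'I_d}) N, frame V f N.
Proof.
move=> <- {k}; set k := \dim V; pose B : 'M[R]_(k, d) := \matrix_i (vbasis V)`_i.
have rowB i : row i B = (vbasis V)`_i by rewrite rowK.
have freeB : row_free B.
  apply: inj_row_free => v; rewrite mulmx_sum_row => vB0.
  have /freeP/(_ (v 0)) h := basis_free (vbasisP V).
  apply/rowP => i; rewrite mxE h // -[RHS]vB0.
  by apply: eq_bigr => j _; rewrite rowB.
have fullB : row_full B^T by rewrite /row_full mxrank_tr.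
pose f0 := fullrankfun fullB; pose m (f : {ffun 'I_k -> 'I_d}) := `|\det (colsub f B)|.
have m0 : 0 < m f0.
  rewrite normr_gt0 -unitfE -unitmxE -unitmx_tr trmx_mxsub.
  exact: fullrowsub_unit.
pose f := [arg max_(f > f0 | true) m f]%O.
have fmax g : m g <= m f.
  by rewrite /f; case: arg_maxP => // h _ hmax; exact: hmax.
pose C := colsub f B; have detC : \det C != 0.
  by rewrite -normr_gt0; exact: lt_le_trans m0 (fmax _).
have CU : C \in unitmx by rewrite unitmxE unitfE.
pose N := invmx C *m B; exists f, N; split.
- move=> i j; transitivity ((invmx C *m C) i j); last by rewrite mulVmx // mxE.
  by rewrite !mxE; apply: eq_bigr => l _; rewrite !mxE.
(* [g] puts column [l] in place of the [i]-th selected one; expanding its minor along that column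
   leaves the cofactors of [C]. *)
- move=> i l; pose g := [ffun j => if j == i then l else f j].
  have -> : N i l = (\det C)^-1 * \det (colsub g B).
    rewrite /N /invmx CU -scalemxAl mxE; congr (_ * _).
    rewrite mxE (expand_det_col _ i); apply: eq_bigr => j _.
    rewrite !mxE ffunE eqxx mulrC; congr (_ * _).
    rewrite /cofactor; congr (_ * \det _); apply/matrixP => a b.
    by rewrite !mxE ffunE [lift i b == i]eq_sym (negPf (neq_lift _ _)).
  by rewrite normrM normfV ler_pdivrMl ?normr_gt0 // mulr1; exact: fmax.
- move=> i; rewrite row_mul mulmx_sum_row memv_suml // => j _.
  by rewrite memvZ // rowB vbasis_mem // mem_nth // size_tuple.
- move=> v vV; pose a : 'rV[R]_k := \row_i coord (vbasis V) i v.
  have vE : v = a *m B.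
    rewrite mulmx_sum_row [LHS](coord_vbasis vV).
    by apply: eq_bigr => i _; rewrite mxE rowB.
  have vC : \row_j v 0 (f j) = a *m C.
    by apply/rowP => j; rewrite mxE vE !mxE; apply: eq_bigr => i _; rewrite !mxE.
  transitivity ((a *m C) *m N).
    by rewrite /N mulmxA -[a *m C *m _]mulmxA mulmxV // mulmx1.
  by rewrite mulmx_sum_row -vC; apply: eq_bigr => j _; rewrite mxE.
Qed.

Lemma frame_inj k V (f : {ffun 'I_k -> 'I_d}) N : frame V f N -> injective f.
Proof.
move=> [Nf _ _ _] i j fij; have := Nf i j; rewrite -fij Nf eqxx.
by case: eqP => // _ /eqP; rewrite oner_eq0.
Qed.

Lemma frame_coord k V (f : {ffun 'I_k -> 'I_d}) N v l : frame V f N -> v \in V ->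
  v 0 l = \sum_j v 0 (f j) * N j l.
Proof.
move=> [_ _ _ /[apply] {1}->]; rewrite summxE.
by apply: eq_bigr => j _; rewrite !mxE.
Qed.

Section Frame.
Context {k : nat} {V W : {vspace 'rV[R]_d}} {f : {ffun 'I_k -> 'I_d}}.
Context {N N' : 'M[R]_(k, d)}.

(** [w] has the same coefficients on the rows of [N'] as [v] on those of [N]; they are coordinates
    of [v], hence bounded by its norm. *)
Lemma frame_dist_sub (c : R) v : frame V f N -> frame W f N' -> 0 <= c ->
  (forall i l, `|N i l - N' i l| <= c) ->
  v \in V -> exists2 w, w \in W & eucl_norm (v - w) <= k%:R * (d%:R * c) * eucl_norm v.
Proof.
move=> [_ _ _ VN] [_ _ NW _] c0 NN vV.
exists (\sum_j v 0 (f j) *: row j N').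
  by rewrite memv_suml // => j _; rewrite memvZ.
rewrite {1}(VN _ vV) -sumrB; apply: le_trans (eucl_norm_sum _ _) _.
apply: (@le_trans _ _ (\sum_(j < k) eucl_norm v * (d%:R * c))).
  apply: ler_sum => j _; rewrite -scalerBr eucl_normZ; apply: ler_pM => //.
  - exact: eucl_norm_ge0.
  - exact: (coord_le_eucl_norm v).
  - by apply: (@eucl_norm_le_coord _ _ _ c) => l; rewrite !mxE NN.
by rewrite sumr_const card_ord -[leLHS]mulr_natl (mulrC (eucl_norm v)) [leLHS]mulrA.
Qed.

(* The row of [N] on which [v] puts its largest coefficient is recovered from [v]
   and the other rows: [v (f i)] times row [i] of [N - N'] equals
   [(v - w) - \sum_(j != i) v (f j) (N_j - N'_j) - \sum_j (v - w) (f j) N'_j]. *)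
Lemma frame_row_close (delta eta rho : R) v w i l :
  frame V f N -> frame W f N' -> v \in V -> w \in W ->
  (forall j, `|v 0 (f j)| <= `|v 0 (f i)|) ->
  0 < rho -> rho <= eucl_norm v -> eucl_norm (v - w) <= eta ->
  0 <= delta -> (forall j, j != i -> `|N j l - N' j l| <= delta) ->
  `|N i l - N' i l| <= k%:R * delta + (1 + k%:R) * eta * (d%:R * k%:R) / rho.
Proof.
move=> fN fN' vV wW vmax rho0 rhov vw delta0 NN.
have [_ N1 _ _] := fN; have [_ N'1 _ _] := fN'.
pose b : R := `|v 0 (f i)|.
(* The entries of [N] are at most 1 in absolute value, so every coordinate of [v] is at most
   [k * b]. *)
have vb : rho <= d%:R * k%:R * b.
  apply: le_trans rhov _; rewrite -mulrA; apply: eucl_norm_le_coord => m.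
  rewrite (frame_coord _ fN vV); apply: le_trans (ler_norm_sum _ _ _) _.
  apply: (@le_trans _ _ (\sum_(j < k) b * 1)).
    by apply: ler_sum => j _; rewrite normrM; apply: ler_pM (vmax j) (N1 j m).
  by rewrite sumr_const card_ord mulr1 mulr_natl.
have b0 : 0 < b.
  rewrite lt_neqAle normr_ge0 andbT; apply: contraTneq vb => <-.
  by rewrite mulr0 -ltNge.
have eta0 : 0 <= eta by exact: le_trans (eucl_norm_ge0 _) vw.
have vwc m : `|v 0 m - w 0 m| <= eta.
  by apply: le_trans vw; apply: le_trans (coord_le_eucl_norm _ m); rewrite !mxE.
have E : v 0 (f i) * (N i l - N' i l) = (v 0 l - w 0 l)
    - \sum_(j | j != i) v 0 (f j) * (N j l - N' j l)
    - \sum_j (v 0 (f j) - w 0 (f j)) * N' j l.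
  rewrite (frame_coord l fN vV) (frame_coord l fN' wW).
  have -> : \sum_(j | j != i) v 0 (f j) * (N j l - N' j l) =
    \sum_j v 0 (f j) * (N j l - N' j l) - v 0 (f i) * (N i l - N' i l).
    by rewrite [in RHS](bigD1 i) //= addrAC subrr add0r.
  have -> : \sum_j v 0 (f j) * (N j l - N' j l) =
    \sum_j v 0 (f j) * N j l - \sum_j v 0 (f j) * N' j l.
    by rewrite -sumrB; apply: eq_bigr => j _; rewrite mulrBr.
  have -> : \sum_j (v 0 (f j) - w 0 (f j)) * N' j l =
    \sum_j v 0 (f j) * N' j l - \sum_j w 0 (f j) * N' j l.
    by rewrite -sumrB; apply: eq_bigr => j _; rewrite mulrBl.
  by ring.
have : b * `|N i l - N' i l| <= eta + b * (k%:R * delta) + k%:R * eta.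
  rewrite -normrM E; apply: le_trans (ler_normB _ _) _; apply: lerD.
    apply: le_trans (ler_normB _ _) _; apply: lerD => //.
    apply: le_trans (ler_norm_sum _ _ _) _.
    apply: (@le_trans _ _ (\sum_(j < k) b * delta)).
      rewrite [leRHS](bigD1 i) //=; apply: ler_wpDl; first by rewrite mulr_ge0 // ltW.
      by apply: ler_sum => j ji; rewrite normrM; apply: ler_pM (vmax j) (NN _ ji).
    by rewrite sumr_const card_ord -[leLHS]mulr_natl mulrCA.
  apply: le_trans (ler_norm_sum _ _ _) _.
  apply: (@le_trans _ _ (\sum_(j < k) eta)).
    apply: ler_sum => j _; rewrite normrM -[leRHS]mulr1.
    exact: ler_pM (vwc _) (N'1 j l).
  by rewrite sumr_const card_ord mulr_natl.
have -> : eta + b * (k%:R * delta) + k%:R * eta =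
  b * (k%:R * delta) + (1 + k%:R) * eta by ring.
rewrite -ler_pdivlMl // mulrDr mulKf ?gt_eqF // => /le_trans; apply.
rewrite lerD2l [leLHS]mulrC -mulrA ler_wpM2l ?mulr_ge0 ?addr_ge0 //.
by rewrite ler_pdivlMr // ler_pdivrMl // mulrC.
Qed.

End Frame.

Lemma grass_dist_frame k V W (f : {ffun 'I_k -> 'I_d}) N N' (c : R) :
  frame V f N -> frame W f N' -> 0 <= c ->
  (forall i l, `|N i l - N' i l| <= c) -> grass_dist V W <= (k%:R * (d%:R * c)) *+ 2.
Proof.
move=> fN fN' c0 NN; apply: grass_dist_le.
- by rewrite !mulr_ge0.
- by move=> v; exact: frame_dist_sub fN fN' c0 NN.
- move=> w; apply: frame_dist_sub fN' fN c0 _ => i l.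
  by rewrite distrC.
Qed.

End GrassmannianFrames.

(** * Finite covers from labellings *)

Section FiniteCovers.
Context {R : realType} {T : Type}.
Variable dist : T -> T -> R.

Lemma diam_le (U : set T) (delta : R) : 0 <= delta ->
  (forall x y, U x -> U y -> dist x y <= delta) -> (diam dist U <= delta%:E)%E.
Proof.
move=> d0 Ud; apply: ge_ereal_sup => _ [->|[[x y] [/= Ux Uy] <-]].
  by rewrite lee_fin.
by rewrite lee_fin Ud.
Qed.

Lemma dist_le_diam (U : set T) (delta : R) x y :
  (diam dist U <= delta%:E)%E -> U x -> U y -> dist x y <= delta.
Proof.
move=> Ud Ux Uy; rewrite -lee_fin; apply: le_trans Ud.
by apply: ereal_sup_ubound; right; exists (x, y).
Qed.

Definition finite_cover (m : nat) (delta : R) (A : set T) : Prop :=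
  exists U : 'I_m -> set T,
    (forall i, (diam dist (U i) <= delta%:E)%E) /\ A `<=` \bigcup_i U i.

(** The points sharing a label form one set of the cover. [lab] is a relation because a point may
    carry several labels, depending on auxiliary choices. *)
Lemma finite_cover_label (L : finType) (S : {pred L}) (lab : T -> L -> Prop)
    (A : set T) (delta : R) : 0 <= delta ->
  (forall x, A x -> exists2 l, l \in S & lab x l) ->
  (forall x y l, lab x l -> lab y l -> dist x y <= delta) ->
  finite_cover #|S| delta A.
Proof.
move=> d0 AS labd; exists (fun i => [set x | lab x (enum_val i)]); split.
  by move=> i; apply: diam_le => // x y; exact: labd.
move=> x /AS[l lS xl]; exists (enum_rank_in lS l) => //=.
by rewrite enum_rankK_in.
Qed.

End FiniteCovers.

(** * Covers of the subspaces containing a difference *)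

Section GrassmannianCovers.
Context {R : realType} {d : nat}.
Implicit Types (x y v w : 'rV[R]_d) (V W : {vspace 'rV[R]_d}) (A : set 'rV[R]_d).

(** Both scaled numbers lie in [0, 2 / delta], so [inord] keeps their integer parts; numbers with
    equal integer parts differ by less than 1. *)
Lemma grid_cell_close (delta a b : R) : 0 < delta -> `|a| <= 1 -> `|b| <= 1 ->
  inord (Num.truncn ((a + 1) / delta)) = inord (Num.truncn ((b + 1) / delta))
    :> 'I_(Num.truncn (2 / delta)).+1 -> `|a - b| <= delta.
Proof.
move=> d0; rewrite !ler_norml => /andP[a1 a2] /andP[b1 b2].
have cell (c : R) : -1 <= c -> c <= 1 ->
    (Num.truncn ((c + 1) / delta) < (Num.truncn (2 / delta)).+1)%N.
  move=> c1 c2; rewrite ltnS; apply: le_truncn; rewrite ler_pM2r ?invr_gt0 //.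
  have : c + 1 <= 2 by lra.
  exact.
have cell0 (c : R) : -1 <= c -> 0 <= (c + 1) / delta.
  by move=> c1; rewrite divr_ge0 ?(ltW d0) //; lra.
move=> /(congr1 val); rewrite /= !inordK ?cell // => ab.
have /andP[] := truncn_itv (cell0 _ a1); have /andP[] := truncn_itv (cell0 _ b1).
rewrite ab -!natr1 !ler_pdivlMr // !ltr_pdivrMr // !mulrDl !mul1r.
lra.
Qed.

(** Row [i] is left out because it will be recovered from the others, the columns selected by [f]
    because a frame is the identity there. *)
Definition free_entries k (f : {ffun 'I_k -> 'I_d}) (i : 'I_k) : {pred 'I_k * 'I_d} :=
  [predX predC1 i & [predC codom f]].

Lemma card_free_entries k (f : {ffun 'I_k -> 'I_d}) i : injective f ->
  #|free_entries f i| = (k.-1 * (d - k))%N.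
Proof.
move=> fI; rewrite cardX cardC1 card_ord; congr (_ * _)%N.
have := cardC [in codom f]; rewrite card_ord.
have -> : #|[in codom f]| = k by rewrite -[RHS]card_ord -(card_codom fI).
by move/(congr1 (subn^~ k)); rewrite addKn.
Qed.

(** The bound [rho] keeps [x - y] away from 0, so that it determines a frame row with a constant
    uniform in the subspace. *)
Definition incident k A (rho : R) : set {vspace 'rV[R]_d} :=
  [set V | \dim V = k /\
    exists x y, [/\ A x, A y, x - y \in V & rho <= eucl_dist x y]].

(* Label [V] by a frame [f], the row [i] where [x - y] has its largest coefficient,
   the cells of the cover containing [x] and [y], and the grid cells of the free entries. *)
Lemma incident_cover k A (rho : R) : (0 < k)%N -> 0 < rho ->
  exists2 C : R, 0 < C & forall (delta : R) n, 0 < delta -> delta <= 1 ->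
    finite_cover eucl_dist n delta A ->
    exists2 m, finite_cover grass_dist m (C * delta) (incident k A rho) &
      m%:R <= C * n%:R ^+ 2 * delta^-1 ^+ (k.-1 * (d - k)).
Proof.
move=> k0 rho0; set K := (k.-1 * (d - k))%N.
(* Comes from [frame_row_close] with [eta] equal to [2 * delta]; the summand 1 gives [1 <= c1], so
   that [c1 * delta] also bounds the other rows. *)
pose c1 : R := k%:R + (1 + k%:R) * 2 * (d%:R * k%:R) / rho + 1.
have c10 : 1 <= c1.
  by rewrite lerDr addr_ge0 // divr_ge0 ?(ltW rho0) // !mulr_ge0 // addr_ge0.
(* [C1] turns closeness of frames into closeness of subspaces; [C2] counts the choices of [f] and
   [i], with a factor 3 per free entry. *)
pose C1 := (k%:R * (d%:R * c1)) *+ 2; pose C2 : R := ((d ^ k * k) * 3 ^ K)%:R.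
have C10 : 0 <= C1 by rewrite mulrn_wge0 // !mulr_ge0 // (le_trans ler01).
have C20 : 0 <= C2 by [].
exists (C1 + C2 + 1) => [|delta n d0 d1 [U [Ud AU]]].
  by rewrite ltr_wpDl // addr_ge0.
pose M := Num.truncn (2 / delta).
pose lT := ({ffun 'I_k -> 'I_d} * 'I_k * 'I_n * 'I_n)%type.
pose LT := (lT * {ffun 'I_k * 'I_d -> 'I_M.+1})%type.
pose D (a : lT) := free_entries a.1.1.1 a.1.1.2.
(* For injective [f] there are exactly [K] free entries; the other entries get the fixed value
   [ord0] and do not add to the count. *)
pose S : {pred LT} := [pred l : LT | injectiveb l.1.1.1.1 &
  l.2 \in pffun_on (ord0 : 'I_M.+1) (D l.1) predT].
pose cell (N : 'M[R]_(k, d)) (a : lT) : {ffun 'I_k * 'I_d -> 'I_M.+1} :=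
  [ffun jl => if jl \in D a then inord (Num.truncn ((N jl.1 jl.2 + 1) / delta)) else ord0].
pose lab V (l : LT) := exists N x y, frame V l.1.1.1.1 N /\
  [/\ x - y \in V, U l.1.1.2 x, U l.1.2 y, rho <= eucl_dist x y &
     l.2 = cell N l.1] /\
  forall j, `|(x - y) 0 (l.1.1.1.1 j)| <= `|(x - y) 0 (l.1.1.1.1 l.1.1.1.2)|.
exists #|S|.
  apply: (@finite_cover_label _ _ _ LT S lab).
  - by rewrite mulr_ge0 ?ltW // ltr_wpDl // addr_ge0.
  - move=> V [dimV [x [y [Ax Ay xyV rxy]]]].
    have [f [N fN]] := frame_exists dimV.
    have [p _ Up] := AU _ Ax; have [q _ Uq] := AU _ Ay.
    pose i := [arg max_(i > Ordinal k0 | true) `|(x - y) 0 (f i)|]%O.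
    exists ((f, i, p, q), cell N (f, i, p, q)).
      rewrite inE /=; apply/andP; split; first exact/injectiveP/(frame_inj fN).
      apply/pffun_onP; split => //; apply/fintype.subsetP => jl.
      by rewrite inE ffunE; case: ifP => //; rewrite eqxx.
    exists N, x, y; split => //; split => // j /=.
    by rewrite /i; case: arg_maxP => // h _; apply.
  - move=> V W [[[[f i] p] q] c] [N [x [y [fN [[/= vV Ux Uy rv cN] vmax]]]]].
    move=> [N' [x' [y' [fN' [[/= wW Ux' Uy' rw cN'] wmax]]]]].
    have NN j l : j != i -> `|N j l - N' j l| <= delta.
      move=> ji; have [/codomP[j' ->]|lf] := boolP (l \in codom f).
        have [-> _ _ _] := fN; have [-> _ _ _] := fN'.
        by rewrite subrr normr0 ltW.
      have /ffunP/(_ (j, l)) : cell N (f, i, p, q) = cell N' (f, i, p, q) by rewrite -cN cN'.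
      have [_ N1 _ _] := fN; have [_ N'1 _ _] := fN'.
      rewrite !ffunE /D !inE /= ji lf /= => /grid_cell_close; exact.
    (* [x] and [x'] share a set of diameter at most [delta], and so do [y] and [y']. *)
    have vw : eucl_norm ((x - y) - (x' - y')) <= delta *+ 2.
      have -> : x - y - (x' - y') = (x - x') - (y - y') by rewrite !opprD addrACA.
      rewrite (le_trans (eucl_normB _ _)) // mulr2n lerD //.
        exact: dist_le_diam (Ud p) Ux Ux'.
      exact: dist_le_diam (Ud q) Uy Uy'.
    have NNc j l : `|N j l - N' j l| <= c1 * delta.
      have [->|ji] := eqVneq j i; last first.
        by apply: le_trans (NN _ l ji) _; rewrite ler_peMl // ltW.
      have := frame_row_close fN fN' vV wW vmax rho0 rv vw (ltW d0) (fun j => NN j l).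
      move=> /le_trans; apply.
      rewrite /c1 [leRHS]mulrDl mul1r; apply: ler_wpDr (ltW d0) _.
      by rewrite le_eqVlt; apply/orP; left; apply/eqP; ring.
    apply: le_trans (grass_dist_frame fN fN' _ NNc) _.
      by rewrite mulr_ge0 ?(ltW d0) // (le_trans ler01).
    have -> : (k%:R * (d%:R * (c1 * delta))) *+ 2 = C1 * delta by rewrite /C1; ring.
    by rewrite ler_pM2r // -addrA lerDl addr_ge0.
(* [delta <= 1] absorbs the extra cell. *)
have M3 : M.+1%:R <= 3 * delta^-1.
  have i1 : 1 <= delta^-1 by rewrite invf_ge1.
  have : M%:R <= 2 / delta by rewrite truncn_le divr_ge0 // ltW.
  rewrite -natr1; lra.
have cardS : (#|S| <= (d ^ k * k * n * n) * M.+1 ^ K)%N.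
  rewrite -sum1_card.
  rewrite -(pair_big_dep (fun a : lT => injectiveb a.1.1.1)
    (fun a c => c \in pffun_on (ord0 : 'I_M.+1) (D a) predT) (fun _ _ => 1%N)) /=.
  apply: (@leq_trans (\sum_(a : lT) M.+1 ^ K)%N); last first.
    by rewrite sum_nat_const !card_prod card_ffun !card_ord.
  rewrite big_mkcond /=; apply: leq_sum => -[[[f i] p] q] _ /=.
  case: ifP => // /injectiveP fI.
  by rewrite sum1_card card_pffun_on card_free_entries // card_ord.
apply: (@le_trans _ _ (C2 * n%:R ^+ 2 * delta^-1 ^+ K)); last first.
  rewrite ler_pM2r ?exprn_gt0 ?invr_gt0 // ler_wpM2r ?exprn_ge0 //.
  by rewrite -addrA addrCA lerDl addr_ge0.
apply: (@le_trans _ _ ((d ^ k * k * n * n)%:R * M.+1%:R ^+ K)).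
  by rewrite -natrX -natrM ler_nat.
rewrite /C2 !natrM !natrX.
have h : (M.+1%:R : R) ^+ K <= 3 ^+ K * delta^-1 ^+ K.
  by rewrite -exprMn lerXn2r ?nnegrE // mulr_ge0 // invr_ge0 ltW.
apply: le_trans (ler_wpM2l _ h) _; first by rewrite !mulr_ge0 // exprn_ge0.
by rewrite le_eqVlt; apply/orP; left; apply/eqP; ring.
Qed.

End GrassmannianCovers.

(** * Null sets and Hausdorff dimension *)

Section HausdorffNull.
Context {R : realType} {T : Type}.
Variable dist : T -> T -> R.
Implicit Types (A B : set T) (s delta : R).

Lemma diam_ge0 A : (0 <= diam dist A)%E.
Proof. by apply: ereal_sup_ubound; left. Qed.

Lemma hausdorff_gauge_ge0 s A : (0 <= hausdorff_gauge dist s A)%E.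
Proof. by rewrite /hausdorff_gauge; case: ifP => // _; exact: poweR_ge0. Qed.

Lemma hausdorff_gauge0 s : hausdorff_gauge dist s set0 = 0%E.
Proof. by rewrite /hausdorff_gauge; case: asboolP. Qed.

Lemma hausdorff_gauge_le s delta A : 0 <= s -> 0 <= delta ->
  (diam dist A <= delta%:E)%E -> (hausdorff_gauge dist s A <= (delta `^ s)%:E)%E.
Proof.
move=> s0 d0 Ad; rewrite /hausdorff_gauge; case: ifP => _.
  by rewrite lee_fin powR_ge0.
rewrite -poweR_EFin; apply: gt0_ler_poweR => //.
  by rewrite in_itv /= diam_ge0 leey.
by rewrite in_itv /= lee_fin d0 leey.
Qed.

Lemma hausdorff_premeasure_ge0 s delta A : (0 <= hausdorff_premeasure dist s delta A)%E.
Proof.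
apply: le_ereal_inf_tmp => _ [U _ <-]; apply: nneseries_ge0 => n _ _.
exact: hausdorff_gauge_ge0.
Qed.

Lemma hausdorff_premeasure_finite_cover s delta eta m A : 0 <= s -> 0 <= eta ->
  eta <= delta -> finite_cover dist m eta A ->
  (hausdorff_premeasure dist s delta A <= (m%:R * eta `^ s)%:E)%E.
Proof.
move=> s0 e0 ed [U [Ud AU]].
(* Empty sets, of gauge 0 for every [s], pad the finite cover to a sequence. *)
pose V i := if insub i is Some j then U j else set0 : set T.
have VU (j : 'I_m) : V j = U j by rewrite /V valK.
have V0 i : (m <= i)%N -> V i = set0 by move=> mi; rewrite /V insubF // ltnNge mi.
apply: (@le_trans _ _ (\sum_(0 <= i <oo) hausdorff_gauge dist s (V i))%E).
  apply: ereal_inf_lbound; exists V => //; split.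
    move=> i; have [im|mi] := ltnP i m.
      rewrite -[i]/(val (Ordinal im)) VU; apply: le_trans (Ud _) _.
      by rewrite lee_fin.
    by rewrite V0 //; apply: diam_le => //; exact: le_trans ed.
  by move=> x /AU[j _ Ux]; exists (val j) => //; rewrite VU.
rewrite (nneseries_split 0 m); last by move=> i _; exact: hausdorff_gauge_ge0.
rewrite add0n (@eseries0 _ _ m) ?adde0; last first.
  by move=> i mi _; rewrite V0 // hausdorff_gauge0.
apply: (@le_trans _ _ (\sum_(0 <= i < m) (eta `^ s)%:E)%E).
  rewrite !big_mkord; apply: lee_sum => i _; rewrite VU.
  exact: hausdorff_gauge_le.
by rewrite sumEFin lee_fin sumr_const_nat subn0 mulr_natl.
Qed.

(** Each [A n] has a cover of total gauge at most [e / 2^(n+1)]; a bijection of the naturals with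
    pairs merges these into one sequence of total at most [e]. *)
Lemma hausdorff_premeasure_bigcup0 s delta (A : nat -> set T) :
  (forall n, hausdorff_premeasure dist s delta (A n) = 0%E) ->
  hausdorff_premeasure dist s delta (\bigcup_n A n) = 0%E.
Proof.
move=> A0; apply/eqP; rewrite eq_le hausdorff_premeasure_ge0 andbT.
apply/lee_addgt0Pr => e e0; rewrite add0e.
have /choice[U UP] n : exists U : nat -> set T,
    [/\ (forall i, (diam dist (U i) <= delta%:E)%E), A n `<=` \bigcup_i U i &
     (\sum_(0 <= i <oo) hausdorff_gauge dist s (U i) <= (e / (2 ^ n.+1)%:R)%:E)%E].
  have /ereal_inf_lt[_ [U [Ud AU] <-] Ue] :
      (hausdorff_premeasure dist s delta (A n) < (e / (2 ^ n.+1)%:R)%:E)%E.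
    by rewrite A0 lte_fin divr_gt0 // ltr0n expn_gt0.
  by exists U; split => //; exact: ltW.
have /card_esym/ppcard_eqP[f] := card_nat2.
pose g (p : nat * nat) := hausdorff_gauge dist s (U p.1 p.2).
have g0 p : (0 <= g p)%E by exact: hausdorff_gauge_ge0.
apply: (@le_trans _ _ (\sum_(0 <= i <oo) g (f i))%E).
  apply: ereal_inf_lbound; exists (fun i => U (f i).1 (f i).2) => //; split.
    by move=> i; have [] := UP (f i).1.
  move=> x [n _ Anx]; have [_ /(_ _ Anx)[j _ Ux] _] := UP n.
  by exists (f^-1%FUN (n, j)) => //=; rewrite invK ?inE.
rewrite nneseries_esumT // -(@reindex_esum _ _ _ setT setT f g) //.
have -> : [set: nat * nat] = [set: nat] `*`` (fun=> [set: nat]) by rewrite eqEsubset; split.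
rewrite -(@esum_esum _ _ _ setT (fun=> setT) (fun i j => g (i, j))) //.
apply: (@le_trans _ _ (\sum_(0 <= n <oo) (e / (2 ^ n.+1)%:R)%:E)%E).
  rewrite -nneseries_esumT; last by move=> n; apply: esum_ge0.
  apply: lee_nneseries => n *; first by apply: esum_ge0.
  by rewrite -nneseries_esumT //; have [] := UP n.
exact: epsilon_trick0 (ltW e0).
Qed.

(** The covers make every premeasure vanish on each [A n], hence on the union, so [s] itself enters
    the infimum. *)
Lemma hausdorff_dim_bigcup_le s (A : nat -> set T) : 0 <= s ->
  (forall n (eps : R), 0 < eps -> exists m eta, [/\ 0 <= eta, eta <= eps,
    finite_cover dist m eta (A n) & m%:R * eta `^ s <= eps]) ->
  (hausdorff_dim dist (\bigcup_n A n) <= s%:E)%E.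
Proof.
move=> s0 As; apply: ereal_inf_lbound; exists s => //; split => //.
suff h delta : 0 < delta -> hausdorff_premeasure dist s delta (\bigcup_n A n) = 0%E.
  apply/eqP; rewrite eq_le; apply/andP; split.
    by apply: ge_ereal_sup => _ [delta d0 <-]; rewrite h.
  by apply: ereal_sup_ubound; exists 1; [exact: ltr01|rewrite h].
move=> d0; apply: hausdorff_premeasure_bigcup0 => n.
apply/eqP; rewrite eq_le hausdorff_premeasure_ge0 andbT.
apply/lee_addgt0Pr => e e0; rewrite add0e.
have [|m [eta [eta0 + cov +]]] := As n (Num.min delta e); first by rewrite lt_min d0.
rewrite !le_min => /andP[etad _] /andP[_ me].
apply: le_trans (hausdorff_premeasure_finite_cover s0 eta0 etad cov) _.
by rewrite lee_fin.
Qed.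

End HausdorffNull.

(** * Covering numbers from the upper box dimension *)

Section UpperBoxDimension.
Context {R : realType} {T : Type}.
Variable dist : T -> T -> R.

Lemma upper_box_dim_cover (A : set T) (t : R) : (upper_box_dim dist A < t%:E)%E ->
  exists2 t' : R, 0 < t' < t & exists2 delta0 : R, 0 < delta0 &
    forall delta, 0 < delta -> delta < delta0 ->
      exists2 n, finite_cover dist n delta A & n%:R <= delta `^ (- t').
Proof.
move=> At; have : (0 <= upper_box_dim dist A)%E by rewrite le_max lexx.
case E : (upper_box_dim dist A) At => [b| |] //; rewrite lte_fin lee_fin => bt b0.
(* Strictly above the dimension, so the bound holds at all small scales; strictly below [t], which
   leaves slack in the final exponent. *)
exists ((b + t) / 2); first by apply/andP; split; lra.
set t' := (b + t) / 2.
have : (upper_box_dim dist A < t'%:E)%E by rewrite E lte_fin /t'; lra.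
rewrite gt_max => /andP[_ /ereal_inf_lt[_ [V V0 <-] Vt]].
have [r /= r0 rV] := V0.
(* Below 1, [- ln delta] is positive and can be cleared from the quotient. *)
exists (Num.min r 1) => [|delta d0]; first by rewrite lt_min r0 ltr01.
rewrite lt_min => /andP[dr d1].
have Vd : V delta by apply: rV => //=; rewrite sub0r normrN gtr0_norm.
have L0 : 0 < - ln delta by rewrite oppr_gt0 ln_lt0 // d0.
have : (lne (covering_number dist A delta) * ((- ln delta)^-1)%:E < t'%:E)%E.
  by apply: le_lt_trans Vt; apply: ereal_sup_ubound; exists delta.
move=> Nt; have : (covering_number dist A delta < (delta `^ (- t'))%:E)%E.
  rewrite ltNge; apply: contraTN Nt => dN; rewrite -leNgt.
  rewrite lee_pdivlMr // -EFinM.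
  have -> : t' * - ln delta = ln (delta `^ (- t')) by rewrite ln_powR; ring.
  rewrite -lne_EFin ?powR_gt0 // lee_lne // in_itv /= leey andbT.
    by rewrite lee_fin powR_ge0.
  by apply: le_trans dN; rewrite lee_fin powR_ge0.
move=> /ereal_inf_lt[_ [n nA <-]]; rewrite lte_fin => /ltW; by exists n.
Qed.

End UpperBoxDimension.

(** * Dimension of the exceptional set *)

Section ExceptionalSet.
Context {R : realType} {d : nat}.
Implicit Types (A : set 'rV[R]_d).

(** As [n] is at most delta^(-t'), the sum is at most a constant times delta^(2(t - t')), which
    tends to 0 with delta. *)
Lemma incident_gauge_small k A (t rho eps : R) : (0 < k)%N ->
  (upper_box_dim eucl_dist A < t%:E)%E -> 0 < rho -> 0 < eps ->
  exists m eta, [/\ 0 <= eta, eta <= eps,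
    finite_cover grass_dist m eta (incident k A rho) &
    m%:R * eta `^ ((k.-1 * (d - k))%:R + 2 * t) <= eps].
Proof.
move=> k0 At rho0 eps0; set K := (k.-1 * (d - k))%N.
have [t' /andP[t'0 t't] [delta0 delta00 AN]] := upper_box_dim_cover At.
have [C C0 CP] := incident_cover A k0 rho0.
set s : R := K%:R + 2 * t; pose p := 2 * (t - t'); pose C' := C * C `^ s.
have p0 : 0 < p by rewrite /p; lra.
have C'0 : 0 < C' by rewrite mulr_gt0 // powR_gt0.
(* In order, the bounds serve the estimate of [n], the cover of the incident subspaces,
   [C * delta <= eps], and the final inequality. *)
pose delta := Num.min (Num.min (delta0 / 2) 1)
  (Num.min (eps / C) ((eps / C') `^ p^-1)).
have d_gt0 : 0 < delta by rewrite !lt_min ltr01 powR_gt0 !divr_gt0.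
have [/andP[d_lt d1] /andP[d2 d3]] :
    (delta <= delta0 / 2) && (delta <= 1) /\
    (delta <= eps / C) && (delta <= (eps / C') `^ p^-1).
  by split; rewrite -le_min /delta ge_min lexx ?orbT.
have [n nA nle] : exists2 n, finite_cover eucl_dist n delta A & n%:R <= delta `^ (- t').
  by apply: AN => //; apply: le_lt_trans d_lt _; lra.
have [m mcov mle] := CP _ _ d_gt0 d1 nA.
exists m, (C * delta); split => //.
- by rewrite mulr_ge0 ?ltW.
- by rewrite mulrC -ler_pdivlMr.
have d_ge0 := ltW d_gt0; have C_ge0 := ltW C0.
have mE : m%:R <= C * (delta `^ (- t')) ^+ 2 * delta `^ (- K%:R).
  apply: le_trans mle _.
  have -> : delta `^ (- K%:R) = delta^-1 ^+ K by rewrite powRN powR_mulrn // exprVn.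
  rewrite ler_wpM2r ?exprn_ge0 ?invr_ge0 // ler_wpM2l //.
  by rewrite lerXn2r ?nnegrE ?powR_ge0.
apply: le_trans (ler_wpM2r (powR_ge0 _ _) mE) _; rewrite powRM //.
have -> : C * delta `^ (- t') ^+ 2 * delta `^ (- K%:R) * (C `^ s * delta `^ s)
  = C' * delta `^ p.
  have -> : p = (- t' + - t') + (- K%:R) + s by rewrite /p /s; ring.
  have dD a b : delta `^ (a + b) = delta `^ a * delta `^ b.
    by rewrite powRD // (gt_eqF d_gt0) implybT.
  by rewrite !dD /C'; ring.
rewrite -ler_pdivlMl // mulrC.
have -> : eps / C' = ((eps / C') `^ p^-1) `^ p.
  by rewrite -powRrM mulVf ?gt_eqF // powRr1 // divr_ge0 ?ltW.
by apply: ge0_ler_powR; rewrite ?nnegrE ?powR_ge0 // ltW.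
Qed.

End ExceptionalSet.

Theorem corollary3p2 (R : realType) (d k : nat) (hk : (1 <= k)%N)
    (hkd : (k < d)%N) (A : set 'rV[R]_d) (t : R) (hA : homogeneous A)
    (hAt : (upper_box_dim eucl_dist A < t%:E)%E)
    (ht : t < (d%:R - k%:R) / 2) :
  exists E : set {vspace 'rV[R]_d},
    [/\ E `<=` Grassmannian k,
        (hausdorff_dim grass_dist E
           <= ((k%:R - 1) * (d%:R - k%:R) + 2 * t)%:E)%E &
        forall V : {vspace 'rV[R]_d}, (Grassmannian k `\` E) V ->
          exists f : subvs_of (ocompl V) -> subvs_of V,
            is_lipschitz f /\ A `<=` graph_of f].
Proof.
(* The union consists of all [V] of dimension [k] that contain a nonzero difference of points of
   [A]. *)
exists (\bigcup_n incident k A n.+1%:R^-1); split.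
- by move=> V [n _ []].
- have -> : (k%:R - 1) * (d%:R - k%:R) = (k.-1 * (d - k))%:R :> R.
    by rewrite natrM natrB ?(ltnW hkd) // -subn1 natrB.
  apply: hausdorff_dim_bigcup_le => [|n eps eps0].
    have [t' /andP[t'0 t't] _] := upper_box_dim_cover hAt.
    by rewrite addr_ge0 // mulr_ge0 // ltW // (lt_trans t'0).
  by apply: incident_gauge_small => //; rewrite invr_gt0.
- move=> V [dimV VE].
  have [x y Ax Ay xyV|c c0 cA] := homogeneous_oproj_bound (V := V) hA.
    apply: contrapT => xy; apply: VE.
    have xy0 : 0 < eucl_dist x y by apply: eucl_norm_gt0; rewrite subr_eq0; apply/eqP.
    (* One more than the integer part exceeds the inverse distance. *)
    exists (Num.truncn (eucl_dist x y)^-1) => //; split => //; exists x, y; split => //.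
    by rewrite invf_ple ?posrE // ltW // truncnS_gt.
  exact: lipschitz_graph_cover c0 cA.
Qed.
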